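(* ($B$-vector quadruple product theorem) Let $\mathbb{F}$ be a field of characteristic not $2$ and let $B$ be an invertible symmetric $3\times 3$ matrix over $\mathbb{F}$. For all vectors $v_1,v_2,v_3,v_4\in\mathbb{V}^3=\mathbb{F}^3$, $$\left\langle v_1,v_2;v_3,v_4\right\rangle_B=(\det B)\left([v_1,v_2,v_4]_B\,v_3-[v_1,v_2,v_3]_B\,v_4\right)=(\det B)\left([v_1,v_3,v_4]_B\,v_2-[v_2,v_3,v_4]_B\,v_1\right).$$
   Context: $\mathbb{V}^3$ is the space of row vectors over $\mathbb{F}$. The $B$-scalar product is $v\cdot_B w=vBw^T$. The Euclidean vector product is $(x_1,y_1,z_1)\times(x_2,y_2,z_2)=(y_1z_2-y_2z_1,\;x_2z_1-x_1z_2,\;x_1y_2-x_2y_1)$. The $B$-vector product is $v\times_B w=(v\times w)\,\mathrm{adj}\,B$ (row vector times matrix), where $\mathrm{adj}\,B=(\det B)B^{-1}$ is the adjugate of $B$. The $B$-scalar triple product is $[u,v,w]_B=u\cdot_B(v\times_B w)$. The $B$-vector quadruple product is $\langle v_1,v_2;v_3,v_4\rangle_B=(v_1\times_B v_2)\times_B(v_3\times_B v_4)$. *)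

(* Defs.v *)
From HB Require Import structures.
From mathcomp Require Import all_boot all_order all_algebra.

Set Implicit Arguments.
Unset Strict Implicit.
Unset Printing Implicit Defensive.

Import GRing.Theory.
Local Open Scope ring_scope.

(* Vectors are row vectors 'rV[F]_3; the coordinates x, y, z are at the
   indices 0, 1, 2 of 'I_3 (the numerals below are those of the ring 'I_3,
   and 2 : 'I_3 does denote the last index). *)

Definition crossv (F : fieldType) (v w : 'rV[F]_3) : 'rV[F]_3 :=
  let x1 := v 0 0 in let y1 := v 0 1 in let z1 := v 0 2 in
  let x2 := w 0 0 in let y2 := w 0 1 in let z2 := w 0 2 in
  \row_(j < 3) [:: y1 * z2 - y2 * z1;
                   x2 * z1 - x1 * z2;
                   x1 * y2 - x2 * y1]`_j.

Definition Bdot (F : fieldType) (B : 'M[F]_3) (v w : 'rV[F]_3) : F :=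
  (v *m B *m w^T) 0 0.

(* \adj B equals \det B *: invmx B when B is invertible. *)
Definition Bcross (F : fieldType) (B : 'M[F]_3) (v w : 'rV[F]_3) : 'rV[F]_3 :=
  crossv v w *m \adj B.

Definition Btriple (F : fieldType) (B : 'M[F]_3) (u v w : 'rV[F]_3) : F :=
  Bdot B u (Bcross B v w).

Definition Bquad (F : fieldType) (B : 'M[F]_3) (v1 v2 v3 v4 : 'rV[F]_3) :
    'rV[F]_3 :=
  Bcross B (Bcross B v1 v2) (Bcross B v3 v4).

(* Main.v *)
Require Import Defs.
From HB Require Import structures.
From mathcomp Require Import all_boot all_order all_algebra.
From mathcomp Require Import ring.

Import GRing.Theory.
Local Open Scope ring_scope.

(** Write [u, v, w] for the Euclidean triple product u . (v x w), which is the
    determinant of the matrix with rows u, v, w.  Multiplicativity of the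
    determinant gives [u A, v A, w A] = \det A [u, v, w], and since u is
    arbitrary this says that (v A x w A) A^T = \det A (v x w)
    ([crossv_mulmx]).

    Take A = \adj B, which is symmetric because B is.  The B-quadruple product
    is (v A x w A) A with v = v1 x v2 and w = v3 x v4, so it is
    \det (\adj B) = (\det B)^2 times the Euclidean quadruple product
    ([Bquad_crossv]).  On the other side, B (\adj B)^T = \det B, so a B-triple
    product is \det B times a Euclidean one ([Btriple_triplev]).  The powers of
    \det B agree, and what is left are the two Euclidean expansions of
    (v1 x v2) x (v3 x v4): apply a x (c x d) = (a . d) c - (a . c) d with
    a = v1 x v2 for the first one, and its mirror image with v3 x v4 as the
    outer factor for the second one.  In coordinates both are polynomial
    identities ([crossv_crossv_r], [crossv_crossv_l]). *)

Definition triplev {F : fieldType} (u v w : 'rV[F]_3) : F :=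
  (u *m (crossv v w)^T) 0 0.

Lemma row3P {F : fieldType} (v w : 'rV[F]_3) :
  v 0 0 = w 0 0 -> v 0 1 = w 0 1 -> v 0 2 = w 0 2 -> v = w.
Proof.
move=> e0 e1 e2; apply/rowP; case=> [[|[|[|//]]] lti].
- by rewrite (_ : Ordinal lti = 0) //; apply: val_inj.
- by rewrite (_ : Ordinal lti = 1) //; apply: val_inj.
- by rewrite (_ : Ordinal lti = 2) //; apply: val_inj.
Qed.

Lemma triplevE {F : fieldType} (u v w : 'rV[F]_3) :
  triplev u v w = u 0 0 * (v 0 1 * w 0 2 - w 0 1 * v 0 2)
                + u 0 1 * (w 0 0 * v 0 2 - v 0 0 * w 0 2)
                + u 0 2 * (v 0 0 * w 0 1 - w 0 0 * v 0 1).
Proof.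
rewrite /triplev !mxE !big_ord_recl big_ord0 !mxE /= addr0 addrA.
rewrite (_ : lift 0 0 = 1); last exact: val_inj.
by rewrite (_ : lift 0 _ = 2) //; apply: val_inj.
Qed.

Lemma triplev_det {F : fieldType} (u v w : 'rV[F]_3) :
  triplev u v w = \det (\matrix_(i < 3) [:: u; v; w]`_i).
Proof.
rewrite triplevE (expand_det_row _ 0) !big_ord_recl big_ord0 /cofactor.
rewrite !(expand_det_row _ 0) !big_ord_recl !big_ord0.
rewrite /cofactor !det_mx11 !mxE /=.
(* Reading entries through natural numbers makes the nested lifts of the
   expansion compute to 0, 1 and 2. *)
have [f fE] : exists f : 'rV[F]_3 -> nat -> F, 
      forall (x : 'rV_3) i, x 0 i = f x i.
  by exists (fun x k => x 0 (inord k)) => x i; rewrite inord_val.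
rewrite !fE /= /bump /=.
ring.
Qed.

Lemma triplev_mulmx {F : fieldType} (A : 'M[F]_3) (u v w : 'rV[F]_3) :
  triplev (u *m A) (v *m A) (w *m A) = \det A * triplev u v w.
Proof.
rewrite !triplev_det mulrC -det_mulmx; congr (\det _).
apply/row_matrixP => i; rewrite row_mul !rowK.
by case: i => [[|[|[|]]]].
Qed.

(** Both sides have the same dot product with every u: pairing u with the left
    one gives the triple product of u A, v A and w A.  The vectors u of the
    standard basis suffice. *)
Lemma crossv_mulmx {F : fieldType} (A : 'M[F]_3) (v w : 'rV[F]_3) :
  crossv (v *m A) (w *m A) *m A^T = \det A *: crossv v w.
Proof.
apply: trmx_inj; apply/row_matrixP=> i; apply/rowP=> j; rewrite !ord1.
rewrite trmx_mul trmxK linearZ /= !rowE mulmxA -scalemxAr [RHS]mxE.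
by rewrite -[LHS]/(triplev _ _ _) triplev_mulmx.
Qed.

Lemma Btriple_triplev {F : fieldType} (B : 'M[F]_3) (u v w : 'rV[F]_3) :
  B^T = B -> Btriple B u v w = \det B * triplev u v w.
Proof.
move=> B_sym; rewrite /Btriple /Bdot /Bcross trmx_mul trmx_adj B_sym.
by rewrite !mulmxA -(mulmxA u) mul_mx_adj mul_mx_scalar -scalemxAl mxE.
Qed.

Lemma det_adj {F : fieldType} n (B : 'M[F]_n.+1) :
  B \in unitmx -> \det (\adj B) = \det B ^+ n.
Proof.
rewrite unitmxE => B_unit; apply: (mulrI B_unit).
by rewrite -exprS -det_mulmx mul_mx_adj det_scalar.
Qed.

(** The outer adjugate in the quadruple product plays the part of A^T in
    [crossv_mulmx] with A = \adj B; this is where the symmetry of B enters. *)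
Lemma Bquad_crossv {F : fieldType} (B : 'M[F]_3) (v1 v2 v3 v4 : 'rV[F]_3) :
  B \in unitmx -> B^T = B ->
  Bquad B v1 v2 v3 v4 = \det B ^+ 2 *: crossv (crossv v1 v2) (crossv v3 v4).
Proof.
move=> B_unit B_sym; rewrite -det_adj // -crossv_mulmx.
by rewrite trmx_adj B_sym.
Qed.

Lemma crossv_crossv_r {F : fieldType} (v1 v2 v3 v4 : 'rV[F]_3) :
  crossv (crossv v1 v2) (crossv v3 v4)
    = triplev v1 v2 v4 *: v3 - triplev v1 v2 v3 *: v4.
Proof. by apply: row3P; rewrite !triplevE !mxE /=; ring. Qed.

Lemma crossv_crossv_l {F : fieldType} (v1 v2 v3 v4 : 'rV[F]_3) :
  crossv (crossv v1 v2) (crossv v3 v4)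
    = triplev v1 v3 v4 *: v2 - triplev v2 v3 v4 *: v1.
Proof. by apply: row3P; rewrite !triplevE !mxE /=; ring. Qed.

Theorem theorem10 (F : fieldType) (char_neq2 : 2%N \notin [pchar F])
    (B : 'M[F]_3) (B_unit : B \in unitmx) (B_sym : B^T = B)
    (v1 v2 v3 v4 : 'rV[F]_3) :
  Bquad B v1 v2 v3 v4
    = \det B *: (Btriple B v1 v2 v4 *: v3 - Btriple B v1 v2 v3 *: v4)
  /\
  \det B *: (Btriple B v1 v2 v4 *: v3 - Btriple B v1 v2 v3 *: v4)
    = \det B *: (Btriple B v1 v3 v4 *: v2 - Btriple B v2 v3 v4 *: v1).
Proof.
rewrite Bquad_crossv // !Btriple_triplev // -!scalerA -!scalerBr.
by rewrite -crossv_crossv_r -crossv_crossv_l scalerA.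
Qed.
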